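(* Let $\mathbb{M}=\langle M,\mathcal{C}\rangle$ be a countable transitive model of $\mathsf{GB}^-$ and let $\mathbb{P}$ be a notion of class forcing for $\mathbb{M}$. If $\mathbb{P}$ satisfies the definability lemma either for ''$v_0\in v_1$'' or for ''$v_0=v_1$'' over $\mathbb{M}$, then $\mathbb{P}$ satisfies the forcing theorem over $\mathbb{M}$ for every $\mathcal{L}^n$-formula (for every $n<\omega$).
   Context: We work in a model $\mathsf{V}$ of $\mathsf{ZFC}$. $\mathsf{ZF}^-$ is $\mathsf{ZF}$ without power set and with Collection instead of Replacement. $\mathsf{GB}^-$ is the two-sorted theory (sets and classes) whose set axioms are those of $\mathsf{ZF}^-$ with class parameters allowed in Separation and Collection and whose class axioms are extensionality, foundation and first-order class comprehension (only set quantifiers). A countable transitive model of $\mathsf{GB}^-$ is a model $\mathbb{M}=\langle M,\mathcal{C}\rangle$ of $\mathsf{GB}^-$ (sets: $M$; classes: $\mathcal{C}\subseteq\mathcal{P}(M)$) such that $M$ is transitive and $M,\mathcal{C}$ are countable in $\mathsf{V}$. A notion of class forcing for $\mathbb{M}$ is a preorder $\mathbb{P}=\langle P,\leq_{\mathbb{P}}\rangle$ with $P,\leq_{\mathbb{P}}\in\mathcal{C}$. A $\mathbb{P}$-name is an object all of whose elements are of the form $\langle\tau,p\rangle$ with $\tau$ a $\mathbb{P}$-name and $p\in\mathbb{P}$; $M^{\mathbb{P}}$ (resp. $\mathcal{C}^{\mathbb{P}}$) is the set of $\mathbb{P}$-names in $M$ (resp. $\mathcal{C}$). A filter $G$ on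 $\mathbb{P}$ is $\mathbb{P}$-generic over $\mathbb{M}$ if it meets every dense subset of $\mathbb{P}$ that is an element of $\mathcal{C}$. For such $G$ and $\sigma\in M^{\mathbb{P}}\cup\mathcal{C}^{\mathbb{P}}$ let $\sigma^G=\{\tau^G\mid\exists p\in G\ \langle\tau,p\rangle\in\sigma\}$, and $M[G]=\{\sigma^G\mid\sigma\in M^{\mathbb{P}}\}$. For $n<\omega$, $\mathcal{L}^n$ is the first-order language extending the language of set theory $\mathcal{L}_\in$ by unary predicate symbols $A_0,\ldots,A_{n-1}$ (so $\mathcal{L}^0=\mathcal{L}_\in$). For an $\mathcal{L}^n$-formula $\varphi(v_0,\ldots,v_{m-1})$, $\vec{\Gamma}=\langle\Gamma_0,\ldots,\Gamma_{n-1}\rangle\in(\mathcal{C}^{\mathbb{P}})^n$, $p\in P$ and $\sigma_0,\ldots,\sigma_{m-1}\in M^{\mathbb{P}}$, write $p\Vdash^{\mathbb{M},\vec\Gamma}_{\mathbb{P}}\varphi(\sigma_0,\ldots,\sigma_{m-1})$ if $\varphi(\sigma_0^G,\ldots,\sigma_{m-1}^G)$ holds in $M_{\vec\Gamma}[G]=\langle M[G],\in,\Gamma_0^G,\ldots,\Gamma_{n-1}^G\rangle$ whenever $G$ is $\mathbb{P}$-generic over $\mathbb{M}$ with $p\in G$. $\mathbb{P}$ satisfies the definability lemma for $\varphi$ over $\mathbb{M}$ if $\{\langle p,\sigma_0,\ldots,\sigma_{m-1}\rangle\in P\times M^{\mathbb{P}}\times\cdots\times M^{\mathbb{P}}\mid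 p\Vdash^{\mathbb{M},\vec\Gamma}_{\mathbb{P}}\varphi(\sigma_0,\ldots,\sigma_{m-1})\}\in\mathcal{C}$ for all $\vec\Gamma\in(\mathcal{C}^{\mathbb{P}})^n$. It satisfies the truth lemma for $\varphi$ over $\mathbb{M}$ if for all $\sigma_0,\ldots,\sigma_{m-1}\in M^{\mathbb{P}}$, $\vec\Gamma\in(\mathcal{C}^{\mathbb{P}})^n$ and every $G$ that is $\mathbb{P}$-generic over $\mathbb{M}$ with $M_{\vec\Gamma}[G]\models\varphi(\sigma_0^G,\ldots,\sigma_{m-1}^G)$ there is $p\in G$ with $p\Vdash^{\mathbb{M},\vec\Gamma}_{\mathbb{P}}\varphi(\sigma_0,\ldots,\sigma_{m-1})$. It satisfies the forcing theorem for $\varphi$ over $\mathbb{M}$ if it satisfies both. *)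

(* Defs.v *)
From HB Require Import structures.
From Stdlib Require Relation_Operators Transitive_Closure.
From mathcomp Require Import all_boot generic_quotient.
From mathcomp Require Import boolp classical_sets functions cardinality.

Set Implicit Arguments.
Unset Strict Implicit.
Unset Printing Implicit Defensive.

(* The universe V of sets: Aczel's well-founded trees modulo bisimulation.
   With the classical axioms of boolp (choice included) it satisfies ZFC;
   the lemmas V_extensionality, ..., V_choice below are the ZFC axioms. *)

Inductive tree : Type := Sup (A : Type) of (A -> tree).

Definition idx (t : tree) : Type := let: Sup A _ := t in A.
Definition sub (t : tree) : idx t -> tree :=
  match t with Sup A f => f end.

Fixpoint bisim (s t : tree) : Prop :=
  match s, t with
  | Sup A f, Sup B g =>
    (forall a, exists b, bisim (f a) (g b)) /\
    (forall b, exists a, bisim (f a) (g b))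
  end.

Lemma bisim_refl t : bisim t t.
Proof. by elim: t => A f IH /=; split=> a; exists a. Qed.

Lemma bisim_sym s t : bisim s t -> bisim t s.
Proof.
elim: s t => A f IH [B g] /= [H1 H2]; split.
- by move=> b; have [a /IH] := H2 b; exists a.
- by move=> a; have [b /IH] := H1 a; exists b.
Qed.

Lemma bisim_trans t s u : bisim s t -> bisim t u -> bisim s u.
Proof.
elim: s t u => A f IH [B g] [C h] /= [H1 H2] [K1 K2]; split.
- move=> a; have [b ab] := H1 a; have [c bc] := K1 b.
  by exists c; apply: IH ab bc.
- move=> c; have [b bc] := K2 c; have [a ab] := H2 b.
  by exists a; apply: IH ab bc.
Qed.

HB.instance Definition _ := gen_eqMixin tree.
HB.instance Definition _ := gen_choiceMixin tree.

Definition bisimb (s t : tree) : bool := `[< bisim s t >].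

Lemma bisimb_refl : reflexive bisimb.
Proof. by move=> t; apply/asboolP; exact: bisim_refl. Qed.

Lemma bisimb_sym : symmetric bisimb.
Proof.
by move=> s t; apply/asboolP/asboolP; apply: bisim_sym.
Qed.

Lemma bisimb_trans : transitive bisimb.
Proof.
move=> t s u /asboolP st /asboolP tu; apply/asboolP; exact: bisim_trans st tu.
Qed.

Canonical bisim_equiv := EquivRel bisimb bisimb_refl bisimb_sym bisimb_trans.

Definition V : Type := {eq_quot bisim_equiv}%qT.

Definition class_of (t : tree) : V := \pi_({eq_quot bisim_equiv})%qT t.
Definition tree_of (x : V) : tree := repr (x : {eq_quot bisim_equiv}%qT).

Lemma tree_ofK x : class_of (tree_of x) = x.
Proof. exact: reprK. Qed.

Lemma class_ofP s t : class_of s = class_of t <-> bisim s t.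
Proof.
by split=> st; [apply/asboolP/(@eqmodP _ bisim_equiv)
               |apply/(@eqmodP _ bisim_equiv)/asboolP].
Qed.

(* The elements of x, indexed by a small type. *)
Definition elts (x : V) : Type := idx (tree_of x).
Definition elt (x : V) (a : elts x) : V := class_of (sub a).

Definition mem (x y : V) : Prop := exists a : elts y, x = elt a.

Declare Scope set_universe_scope.
Delimit Scope set_universe_scope with V.
Open Scope set_universe_scope.
Notation "x ∈ y" := (mem x y) (at level 70, no associativity)
  : set_universe_scope.

Definition family (A : Type) (f : A -> V) : V :=
  class_of (Sup (fun a => tree_of (f a))).

Lemma mem_class_of x t : x ∈ class_of t <-> exists a : idx t, x = class_of (sub a).
Proof.
rewrite /mem /elt /elts.
have : bisim (tree_of (class_of t)) t by apply/class_ofP; rewrite tree_ofK.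
case: t (tree_of _) => [B g] [A f] /= [H1 H2]; split.
- by move=> [a ->]; have [b ab] := H1 a; exists b; apply/class_ofP.
- by move=> [b ->]; have [a ab] := H2 b; exists a; apply/esym/class_ofP.
Qed.

Lemma mem_family A (f : A -> V) x : x ∈ family f <-> exists a, x = f a.
Proof.
by rewrite mem_class_of /=; split=> -[a ->]; exists a; rewrite tree_ofK.
Qed.

Lemma mem_elt x (a : elts x) : elt a ∈ x.
Proof. by exists a. Qed.

Lemma V_extensionality x y : (forall z, z ∈ x <-> z ∈ y) -> x = y.
Proof.
move=> xy; rewrite -[x]tree_ofK -[y]tree_ofK; apply/class_ofP.
have {xy} : forall z, z ∈ class_of (tree_of x) <-> z ∈ class_of (tree_of y).
  by move=> z; rewrite !tree_ofK.
case: (tree_of x) (tree_of y) => [A f] [B g] xy /=; split.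
- move=> a; have /mem_class_of[b ab] : class_of (f a) ∈ class_of (Sup g).
    by apply/xy/mem_class_of; exists a.
  by exists b; apply/class_ofP.
- move=> b; have /mem_class_of[a ab] : class_of (g b) ∈ class_of (Sup f).
    by apply/xy/mem_class_of; exists b.
  by exists a; apply/class_ofP.
Qed.

Lemma V_foundation : well_founded mem.
Proof.
suff H t : Acc mem (class_of t) by move=> x; rewrite -[x]tree_ofK.
by elim: t => A f IH; constructor=> y /mem_class_of[a ->]; exact: IH.
Qed.

Definition upair (x y : V) : V := family (fun b : bool => if b then x else y).

Lemma V_pairing x y z : z ∈ upair x y <-> z = x \/ z = y.
Proof.
rewrite mem_family; split; first by move=> [[] ->]; [left|right].
by move=> [->|->]; [exists true|exists false].
Qed.

Definition union (x : V) : V :=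
  family (fun a : {a : elts x & elts (elt a)} => elt (projT2 a)).

Lemma V_union x z : z ∈ union x <-> exists y, y ∈ x /\ z ∈ y.
Proof.
rewrite mem_family; split.
- by move=> [[a b] ->] /=; exists (elt a); split; exact: mem_elt.
- by move=> [_ [[a ->] [b ->]]]; exists (existT _ a b).
Qed.

Definition sep (x : V) (Q : V -> Prop) : V :=
  family (fun a : {a : elts x | Q (elt a)} => elt (proj1_sig a)).

Lemma V_separation x Q z : z ∈ sep x Q <-> z ∈ x /\ Q z.
Proof.
rewrite mem_family; split; first by move=> [[a Qa] ->]; split=> //; exists a.
by move=> [[a ->] Qa]; exists (exist _ a Qa).
Qed.

Definition image (F : V -> V) (x : V) : V := family (fun a : elts x => F (elt a)).

Lemma V_replacement F x z : z ∈ image F x <-> exists y, y ∈ x /\ z = F y.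
Proof.
rewrite mem_family; split; first by move=> [a ->]; exists (elt a); split=> //; exists a.
by move=> [_ [[a ->] ->]]; exists a.
Qed.

Lemma V_powerset x : exists y, forall z, z ∈ y <-> forall w, w ∈ z -> w ∈ x.
Proof.
exists (family (fun Q : elts x -> Prop =>
  family (fun a : {a | Q a} => elt (proj1_sig a)))) => z.
rewrite mem_family; split.
- by move=> [Q ->] w /mem_family[[a Qa] ->]; exact: mem_elt.
- move=> zx; exists (fun a => elt a ∈ z); apply: V_extensionality => w.
  rewrite mem_family; split; last by move=> [[a ?] ->].
  by move=> wz; have [a wa] := zx w wz; rewrite wa in wz *; exists (exist _ a wz).
Qed.

Lemma V_infinity : exists w, (exists e, e ∈ w /\ forall z, ~ z ∈ e) /\
  forall x, x ∈ w -> exists s, s ∈ w /\ forall z, z ∈ s <-> z ∈ x \/ z = x.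
Proof.
pose e := family (fun x : void => match x return V with end).
pose S x := union (upair x (upair x x)).
exists (family (fun n => iter n S e)); split.
  exists e; split; first by apply/mem_family; exists 0.
  by move=> z /mem_family[[]].
move=> _ /mem_family[n ->]; exists (iter n.+1 S e).
split; first by apply/mem_family; exists n.+1.
move=> z; rewrite /= V_union; split.
  by move=> [y [/V_pairing[->|->]]]; [left|move=> /V_pairing[]; right].
move=> [zx|->]; first by exists (iter n S e); split=> //; apply/V_pairing; left.
exists (upair (iter n S e) (iter n S e)).
by split; apply/V_pairing; [right|left].
Qed.

Lemma V_choice x :
  (forall y, y ∈ x -> exists z, z ∈ y) ->
  (forall y y' z, y ∈ x -> y' ∈ x -> z ∈ y -> z ∈ y' -> y = y') ->
  exists c, forall y, y ∈ x -> exists ! z, z ∈ y /\ z ∈ c.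
Proof.
move=> ne dj.
have [F FP] : exists F : V -> V, forall y, y ∈ x -> F y ∈ y.
  have /choice[F FP] : forall y, exists z, y ∈ x -> z ∈ y.
    by move=> y; have [/ne[z]|yx] := pselect (y ∈ x); [exists z|exists y => /yx].
  by exists F.
exists (image F x) => y yx; exists (F y); split.
  by split; [exact: FP|apply/V_replacement; exists y].
by move=> z [zy /V_replacement[y' [y'x zE]]]; rewrite zE (dj y y' z)// zE; exact: FP.
Qed.

(* Kuratowski pairs; tuples are nested to the left. *)
Definition opair (x y : V) : V := upair (upair x x) (upair x y).
Notation "⟨ x , y ⟩" := (opair x y) (at level 0, x at level 99, y at level 99)
  : set_universe_scope.

Lemma upair_injr x y y' : upair x y = upair x y' -> y = y'.
Proof.
move=> E; have : y' ∈ upair x y by rewrite E V_pairing; right.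
have : y ∈ upair x y' by rewrite -E V_pairing; right.
by rewrite !V_pairing => -[->|->]// [->|->].
Qed.

Lemma opair_inj x y x' y' : ⟨x, y⟩ = ⟨x', y'⟩ -> x = x' /\ y = y'.
Proof.
move=> E; have xx' : x = x'.
  have : upair x x ∈ ⟨x', y'⟩ by rewrite -E V_pairing; left.
  rewrite V_pairing => -[] F; have : x' ∈ upair x x by rewrite F V_pairing; left.
    by rewrite V_pairing => -[].
  by rewrite V_pairing => -[].
by split=> //; rewrite -xx' in E; exact: upair_injr (upair_injr E).
Qed.

(* Names and their evaluation make sense for any sets P and G. *)
Inductive is_name (P : V) : V -> Prop :=
| IsName s : (forall x, x ∈ s -> exists t p, x = ⟨t, p⟩ /\ is_name P t /\ p ∈ P) ->
    is_name P s.

Definition in_dom (t s : V) : Prop := exists p, ⟨t, p⟩ ∈ s.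

Lemma mem_unionU t p s : ⟨t, p⟩ ∈ s -> t ∈ union (union s).
Proof.
move=> tps; apply/V_union; exists (upair t t).
split; last by apply/V_pairing; left.
by apply/V_union; exists ⟨t, p⟩; split=> //; apply/V_pairing; left.
Qed.

Lemma in_dom_wf : well_founded in_dom.
Proof.
have sub_wf : well_founded (Relation_Operators.clos_trans V mem).
  exact: Transitive_Closure.wf_clos_trans V_foundation.
move=> s; elim/(well_founded_ind sub_wf): s => s IH; constructor=> t [p tps].
apply: IH; have [y [/V_union[z [zs yz]] ty]] := iffLR (V_union _ _) (mem_unionU tps).
apply: Relation_Operators.t_trans (Relation_Operators.t_step _ _ _ _ ty) _.
apply: Relation_Operators.t_trans (Relation_Operators.t_step _ _ _ _ yz) _.
exact: Relation_Operators.t_step.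
Qed.

(* eval G s is s^G; see evalP for its characterization. *)
Definition eval_step (G s : V) (rec : forall t, in_dom t s -> V) : V :=
  family (fun a : {a : elts (union (union s)) | exists p, ⟨elt a, p⟩ ∈ s /\ p ∈ G} =>
    rec (elt (proj1_sig a))
        (let: ex_intro p (conj h _) := proj2_sig a in ex_intro _ p h)).

Definition eval (G : V) : V -> V := Fix in_dom_wf (fun=> V) (@eval_step G).

Lemma evalP G s x :
  x ∈ eval G s <-> exists t, (exists p, p ∈ G /\ ⟨t, p⟩ ∈ s) /\ x = eval G t.
Proof.
rewrite /eval Fix_eq; last first.
  by move=> y f g fg; congr eval_step; apply: functional_extensionality_dep => t;
    apply: functional_extensionality_dep => h; exact: fg.
rewrite mem_family; split.
  by move=> [[a [p [h pG]]] ->] /=; exists (elt a); split=> //; exists p.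
move=> [t [[p [pG tps]] ->]].
have [a ta] := mem_unionU tps; rewrite ta in tps *.
by exists (exist _ a (ex_intro _ p (conj tps pG))).
Qed.

(* [formula n m]: formulas of set theory expanded by n unary predicates, with
   free variables v_0, .., v_(m-1).  Variables are de Bruijn indices: fEx binds
   variable 0 of its argument and shifts the others. *)
Inductive formula (n : nat) : nat -> Type :=
| fMem m (i j : 'I_m) : formula n m
| fEq m (i j : 'I_m) : formula n m
| fPred m (k : 'I_n) (i : 'I_m) : formula n m
| fNot m (phi : formula n m) : formula n m
| fAnd m (phi psi : formula n m) : formula n m
| fEx m (phi : formula n m.+1) : formula n m.
Arguments fMem n {m} i j.
Arguments fEq n {m} i j.
Arguments fPred {n m} k i.

(* Satisfaction in the structure with domain D, the membership relation of V
   and the unary predicates A_0, .., A_(n-1). *)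
Fixpoint sat (n : nat) (D : V) (A : n.-tuple V) (m : nat) (phi : formula n m)
    {struct phi} : m.-tuple V -> Prop :=
  match phi in formula _ m return m.-tuple V -> Prop with
  | fMem _ i j => fun e => tnth e i ∈ tnth e j
  | fEq _ i j => fun e => tnth e i = tnth e j
  | fPred _ k i => fun e => tnth e i ∈ tnth A k
  | fNot _ psi => fun e => ~ sat D A psi e
  | fAnd _ psi chi => fun e => sat D A psi e /\ sat D A chi e
  | fEx _ psi => fun e => exists x, x ∈ D /\ sat D A psi [tuple of x :: e]
  end.

Definition tuple_in (n : nat) (Q : V -> Prop) (t : n.-tuple V) : Prop :=
  forall i, Q (tnth t i).

(* GB^-: only set quantifiers occur in the formulas of the schemes; classes
   enter them as parameters, through the unary predicates. *)
Record GBm_model (M C : V) : Prop := {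
  GBm_classes : forall X, X ∈ C -> forall x, x ∈ X -> x ∈ M;
  GBm_set_extensionality : forall x y, x ∈ M -> y ∈ M ->
    (forall z, z ∈ M -> (z ∈ x <-> z ∈ y)) -> x = y;
  GBm_set_foundation : forall x, x ∈ M -> (exists y, y ∈ M /\ y ∈ x) ->
    exists y, y ∈ M /\ y ∈ x /\ forall z, z ∈ M -> z ∈ y -> ~ z ∈ x;
  GBm_pairing : forall x y, x ∈ M -> y ∈ M ->
    exists z, z ∈ M /\ forall w, w ∈ M -> (w ∈ z <-> w = x \/ w = y);
  GBm_union : forall x, x ∈ M ->
    exists u, u ∈ M /\
      forall w, w ∈ M -> (w ∈ u <-> exists y, y ∈ M /\ y ∈ x /\ w ∈ y);
  GBm_infinity : exists w, w ∈ M /\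
    (exists e, e ∈ M /\ e ∈ w /\ forall z, z ∈ M -> ~ z ∈ e) /\
    forall x, x ∈ M -> x ∈ w ->
      exists s, s ∈ M /\ s ∈ w /\ forall z, z ∈ M -> (z ∈ s <-> z ∈ x \/ z = x);
  GBm_separation : forall n m (phi : formula n m.+1) (A : n.-tuple V) (e : m.-tuple V),
    tuple_in (mem^~ C) A -> tuple_in (mem^~ M) e -> forall a, a ∈ M ->
    exists b, b ∈ M /\
      forall x, x ∈ M -> (x ∈ b <-> x ∈ a /\ sat M A phi [tuple of x :: e]);
  GBm_collection : forall n m (phi : formula n m.+2) (A : n.-tuple V) (e : m.-tuple V),
    tuple_in (mem^~ C) A -> tuple_in (mem^~ M) e -> forall a, a ∈ M ->
    (forall x, x ∈ M -> x ∈ a ->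
      exists y, y ∈ M /\ sat M A phi [tuple of x :: y :: e]) ->
    exists b, b ∈ M /\ forall x, x ∈ M -> x ∈ a ->
      exists y, y ∈ M /\ y ∈ b /\ sat M A phi [tuple of x :: y :: e];
  GBm_class_extensionality : forall X Y, X ∈ C -> Y ∈ C ->
    (forall z, z ∈ M -> (z ∈ X <-> z ∈ Y)) -> X = Y;
  GBm_class_foundation : forall X, X ∈ C -> (exists y, y ∈ M /\ y ∈ X) ->
    exists y, y ∈ M /\ y ∈ X /\ forall z, z ∈ M -> z ∈ y -> ~ z ∈ X;
  GBm_comprehension : forall n m (phi : formula n m.+1) (A : n.-tuple V) (e : m.-tuple V),
    tuple_in (mem^~ C) A -> tuple_in (mem^~ M) e ->
    exists X, X ∈ C /\
      forall x, x ∈ M -> (x ∈ X <-> sat M A phi [tuple of x :: e])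
}.

Definition transitive_set (x : V) : Prop := forall y z, y ∈ x -> z ∈ y -> z ∈ x.

Definition countable_set (x : V) : Prop := countable [set y | y ∈ x]%classic.

Definition countable_transitive_model_GBm (M C : V) : Prop :=
  [/\ GBm_model M C, transitive_set M, countable_set M & countable_set C].

(* A forcing is given by its domain P and its order le, a set of pairs. *)
Definition preorder_on (P le : V) : Prop :=
  [/\ forall z, z ∈ le -> exists p q, z = ⟨p, q⟩ /\ p ∈ P /\ q ∈ P,
      forall p, p ∈ P -> ⟨p, p⟩ ∈ le
    & forall p q r, ⟨p, q⟩ ∈ le -> ⟨q, r⟩ ∈ le -> ⟨p, r⟩ ∈ le].

Definition class_forcing (C P le : V) : Prop :=
  [/\ preorder_on P le, P ∈ C & le ∈ C].

Definition filter_on (P le G : V) : Prop :=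
  [/\ forall p, p ∈ G -> p ∈ P,
      exists p, p ∈ G,
      forall p q, p ∈ G -> ⟨p, q⟩ ∈ le -> q ∈ G
    & forall p q, p ∈ G -> q ∈ G -> exists r, [/\ r ∈ G, ⟨r, p⟩ ∈ le & ⟨r, q⟩ ∈ le]].

Definition dense_in (P le D : V) : Prop :=
  (forall d, d ∈ D -> d ∈ P) /\
  forall p, p ∈ P -> exists d, d ∈ D /\ ⟨d, p⟩ ∈ le.

Definition generic (C P le G : V) : Prop :=
  filter_on P le G /\
  forall D, D ∈ C -> dense_in P le D -> exists p, p ∈ G /\ p ∈ D.

Definition names (N P : V) : V := sep N (is_name P).

Definition extension (M P G : V) : V := image (eval G) (names M P).

Definition eval_tuple (G : V) (n : nat) (s : n.-tuple V) : n.-tuple V :=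
  [tuple of map (eval G) s].

Definition ext_sat (M P G : V) (n : nat) (Gamma : n.-tuple V)
    (m : nat) (phi : formula n m) (s : m.-tuple V) : Prop :=
  sat (extension M P G) (eval_tuple G Gamma) phi (eval_tuple G s).

Definition forces (M C P le : V) (n : nat) (Gamma : n.-tuple V) (p : V)
    (m : nat) (phi : formula n m) (s : m.-tuple V) : Prop :=
  forall G, generic C P le G -> p ∈ G -> ext_sat M P G Gamma phi s.

Definition tuple_code (m : nat) (p : V) (s : m.-tuple V) : V := foldl opair p s.

Definition definability_lemma (M C P le : V) (n m : nat) (phi : formula n m) : Prop :=
  forall Gamma : n.-tuple V, tuple_in (mem^~ (names C P)) Gamma ->
  exists X, X ∈ C /\ forall z, z ∈ X <->
    exists p (s : m.-tuple V), [/\ z = tuple_code p s, p ∈ P,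
      tuple_in (mem^~ (names M P)) s & forces M C P le Gamma p phi s].

Definition truth_lemma (M C P le : V) (n m : nat) (phi : formula n m) : Prop :=
  forall (s : m.-tuple V) (Gamma : n.-tuple V),
  tuple_in (mem^~ (names M P)) s -> tuple_in (mem^~ (names C P)) Gamma ->
  forall G, generic C P le G -> ext_sat M P G Gamma phi s ->
  exists p, p ∈ G /\ forces M C P le Gamma p phi s.

Definition forcing_theorem (M C P le : V) (n m : nat) (phi : formula n m) : Prop :=
  definability_lemma M C P le phi /\ truth_lemma M C P le phi.

Definition v0_in_v1 : formula 0 2 := fMem 0 ord0 ord_max.
Definition v0_eq_v1 : formula 0 2 := fEq 0 ord0 ord_max.

(* Main.v *)
(* Call a property Phi(G, e) of a generic G and an assignment e of names
   captured if there is a first-order relation O over M with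
   Phi(G, e) <-> exists p in G, O(p, e).  Captured properties satisfy the truth
   lemma trivially, and they are closed under conjunction, negation and
   quantification over names, because G meets the class of those p that lie
   below an element of O or have no such extension.  Negation also yields
   definability: p forces Phi iff no extension of p lies below an element
   witnessing ~Phi.

   Only s^G = t^G has to be captured.  If "v0 = v1" is definable, its truth
   lemma follows by induction on s: equality of elements of s with arbitrary
   names is captured by induction, hence so are both inclusions between s^G and
   t^G for fixed s and t.  If "v0 in v1" is definable, so is "v0 = v1": p forces
   s = t iff p forces that s belongs to the name {<t, p>}. *)
From mathcomp Require Import all_boot.
From mathcomp Require Import boolp classical_sets cardinality.
Require Import Defs.

Set Implicit Arguments.
Unset Strict Implicit.
Unset Printing Implicit Defensive.

(** * First-order relations over the model, on infinite assignments *)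

Definition scons (x : V) (e : nat -> V) : nat -> V :=
  fun i => if i is j.+1 then e j else x.
Notation "x .: e" := (scons x e) (at level 55, right associativity).

Definition env_in (D : V) (e : nat -> V) : Prop := forall i, e i ∈ D.

Lemma env_in_scons D x e : x ∈ D -> env_in D e -> env_in D (x .: e).
Proof. by move=> xD eD [|i] //; exact: eD. Qed.

Lemma scons_eta (e : nat -> V) : e = e 0 .: (fun i => e i.+1).
Proof. by apply: funext => -[]. Qed.

Lemma mktuple_cons (f : nat -> V) m :
  [tuple f i | i < m.+1] = [tuple of f 0 :: [tuple f i.+1 | i < m]].
Proof.
apply: eq_from_tnth => i; rewrite tnth_mktuple.
case: (unliftP ord0 i) => [j|] ->; last by rewrite tnth0.
by rewrite tnthS tnth_mktuple.
Qed.

(* A shallow embedding: R is a property of assignments, and variable i is e i. *)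
Inductive first_order (M C : V) : ((nat -> V) -> Prop) -> Prop :=
| fo_mem i j : first_order M C (fun e => e i ∈ e j)
| fo_eq i j : first_order M C (fun e => e i = e j)
| fo_class X i : X ∈ C -> first_order M C (fun e => e i ∈ X)
| fo_not R : first_order M C R -> first_order M C (fun e => ~ R e)
| fo_and R S : first_order M C R -> first_order M C S ->
    first_order M C (fun e => R e /\ S e)
| fo_ex_scons R : first_order M C R ->
    first_order M C (fun e => exists x, x ∈ M /\ R (x .: e))
| fo_equiv R S : first_order M C R ->
    (forall e, env_in M e -> (R e <-> S e)) -> first_order M C S.

(* A' only has to contain the classes of A, so that the representations of two
   relations can be given the same list of classes and combined. *)
Lemma fo_sat M C R : first_order M C R ->
  exists n (A : n.-tuple V) m0, tuple_in (mem^~ C) A /\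
    forall n' (A' : n'.-tuple V), (forall k, exists k', tnth A' k' = tnth A k) ->
    forall m, m0 <= m -> exists phi : formula n' m,
    forall e, env_in M e -> (R e <-> sat M A' phi [tuple e i | i < m]).
Proof.
elim=> {R}.
- move=> i j; exists 0, [tuple], (maxn i j).+1; split=> [[]//|n A _ m].
  rewrite gtn_max => /andP[im jm]; exists (fMem n (Ordinal im) (Ordinal jm)) => e _ /=.
  by rewrite !tnth_mktuple.
- move=> i j; exists 0, [tuple], (maxn i j).+1; split=> [[]//|n A _ m].
  rewrite gtn_max => /andP[im jm]; exists (fEq n (Ordinal im) (Ordinal jm)) => e _ /=.
  by rewrite !tnth_mktuple.
- move=> X i XC; exists 1, [tuple X], i.+1; split.
    by move=> k; rewrite (tnth_nth X) ord1.
  move=> n A /(_ ord0)[k Ak] m im; exists (fPred k (Ordinal im)) => e _ /=.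
  by rewrite tnth_mktuple Ak (tnth_nth X).
- move=> R _ [n [A [m0 [AC RA]]]]; exists n, A, m0; split=> // n' A' AA' m m0m.
  have [phi phiP] := RA _ _ AA' _ m0m.
  by exists (fNot phi) => e eM /=; rewrite phiP.
- move=> R S _ [n [A [m [AC RA]]]] _ [n' [B [m' [BC SB]]]].
  exists (n + n'), (cat_tuple A B), (maxn m m'); split.
    move=> k; case: (split_ordP k) => j ->.
      by rewrite tnth_lshift; exact: AC.
    by rewrite tnth_rshift; exact: BC.
  move=> n'' D ABD m''; rewrite geq_max => /andP[mm mm'].
  have [|phi phiP] := RA _ D _ _ mm.
    by move=> k; have := ABD (lshift _ k); rewrite tnth_lshift.
  have [|psi psiP] := SB _ D _ _ mm'.
    by move=> k; have := ABD (rshift _ k); rewrite tnth_rshift.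
  by exists (fAnd phi psi) => e eM /=; rewrite phiP// psiP.
- move=> R _ [n [A [m0 [AC RA]]]]; exists n, A, m0; split=> // n' A' AA' m m0m.
  have [phi phiP] := RA _ _ AA' _ (leqW m0m).
  have cons x (e : nat -> V) : [tuple of x :: [tuple e i | i < m]] = [tuple (x .: e) i | i < m.+1].
    by rewrite mktuple_cons.
  exists (fEx phi) => e eM /=; split=> -[x [xM Rx]]; exists x; split=> //.
    by rewrite cons; apply/phiP => //; exact: env_in_scons.
  by apply/phiP; [exact: env_in_scons|rewrite -cons].
- move=> R S _ [n [A [m0 [AC RA]]]] RS; exists n, A, m0; split=> // n' A' AA' m m0m.
  have [phi phiP] := RA _ _ AA' _ m0m.
  by exists phi => e eM; rewrite -RS// phiP.
Qed.

(** The finitely many variables read by a representing formula become the set parameters of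
    [GBm_comprehension]. Classes consist of elements of [M], so the equivalence holds for every set
    [x]. *)
Lemma fo_comprehension M C R e : GBm_model M C -> first_order M C R -> env_in M e ->
  exists X, X ∈ C /\ forall x, x ∈ X <-> x ∈ M /\ R (x .: e).
Proof.
move=> MC /fo_sat[n [A [m [AC RA]]]] eM.
have [|phi phiP] := RA _ A _ _ (leqnSn m); first by move=> k; exists k.
have [|X [XC XP]] := GBm_comprehension MC phi AC (e := [tuple e i | i < m]).
  by move=> i; rewrite tnth_mktuple; exact: eM.
exists X; split=> // x.
have key : x ∈ M -> (x ∈ X <-> R (x .: e)).
  move=> xM; rewrite XP// phiP; last exact: env_in_scons.
  by rewrite mktuple_cons.
split=> [xX|[xM Rx]]; last exact/key.
have xM := GBm_classes MC XC xX.
by split=> //; apply/key.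
Qed.

Lemma fo_rename M C R f : first_order M C R -> first_order M C (fun e => R (e \o f)).
Proof.
move=> foR; elim: foR f => {R}.
- by move=> i j f; exact: fo_mem.
- by move=> i j f; exact: fo_eq.
- by move=> X i XC f; exact: fo_class.
- by move=> R _ IH f; exact: fo_not.
- by move=> R S _ IHR _ IHS f; exact: fo_and.
(* Under the quantifier the renaming fixes the bound variable 0 and acts as [f] on the shifted
   ones. *)
- move=> R _ IH f; pose g i := if i is j.+1 then (f j).+1 else 0.
  apply: fo_equiv (fo_ex_scons (IH g)) _ => e _.
  have E x : (x .: e) \o g = x .: (e \o f) by apply: funext => -[].
  by split=> -[x [xM Rx]]; exists x; split; rewrite // ?E// -E.
- by move=> R S _ IH RS f; apply: fo_equiv (IH f) _ => e eM; apply: RS => i; exact: eM.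
Qed.

(** Stated for maps of assignments, so that the side condition of [fo_subst] can be solved by
    following the shape of [g]. *)
Definition renaming (g : (nat -> V) -> nat -> V) : Prop :=
  exists f : nat -> nat, forall e, g e = e \o f.

Lemma renaming_shift k : renaming (fun e i => e (k + i)).
Proof. by exists (addn k). Qed.

Lemma renaming_scons k g : renaming g -> renaming (fun e => e k .: g e).
Proof.
move=> [f gf]; exists (fun i => if i is j.+1 then f j else k) => e.
by apply: funext => -[|i] //=; rewrite gf.
Qed.

Section FirstOrder.
Variables M C : V.
Notation fo := (first_order M C).

Lemma fo_subst R g : fo R -> renaming g -> fo (fun e => R (g e)).
Proof.
by move=> foR [f gf]; apply: fo_equiv (fo_rename f foR) _ => e _; rewrite gf.
Qed.

(** A form of [fo_ex_scons] with the bound value as a separate argument, so that a written-out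
    quantifier unifies with the conclusion. *)
Lemma fo_ex (R : V -> (nat -> V) -> Prop) :
  fo (fun e => R (e 0) (fun i => e i.+1)) ->
  fo (fun e => exists x, x ∈ M /\ R x e).
Proof. exact: fo_ex_scons. Qed.

Lemma fo_imply R S : fo R -> fo S -> fo (fun e => R e -> S e).
Proof.
move=> foR foS; apply: fo_equiv (fo_not (fo_and foR (fo_not foS))) _ => e _.
split; last by tauto.
by move=> nRS Re; apply: contrapT => nSe; apply: nRS.
Qed.

Lemma fo_or R S : fo R -> fo S -> fo (fun e => R e \/ S e).
Proof.
move=> foR foS; apply: fo_equiv (fo_imply (fo_not foR) foS) _ => e _.
split; last by tauto.
by move=> RS; have [|/RS] := pselect (R e); [left|right].
Qed.

Lemma fo_iff R S : fo R -> fo S -> fo (fun e => R e <-> S e).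
Proof. by move=> foR foS; apply: fo_and; exact: fo_imply. Qed.

Lemma fo_all (R : V -> (nat -> V) -> Prop) :
  fo (fun e => R (e 0) (fun i => e i.+1)) ->
  fo (fun e => forall x, x ∈ M -> R x e).
Proof.
move=> foR.
have foE : fo (fun e => exists x, x ∈ M /\ ~ R x e).
  by apply: fo_ex; exact: fo_not.
apply: fo_equiv (fo_not foE) _ => e _; split=> [nE x xM|A [x [/A]]//].
by apply: contrapT => nR; apply: nE; exists x.
Qed.

Hypothesis MC : GBm_model M C.
Hypothesis Mtrans : transitive_set M.

(** Pairs are absolute: by transitivity all elements of [e k] lie in [M], so comparing elements
    within [M] suffices. *)
Lemma fo_eq_upair i j k : fo (fun e => e k = upair (e i) (e j)).
Proof.
have foU : fo (fun e => forall w, w ∈ M -> (w ∈ e k <-> w = e i \/ w = e j)).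
  apply: fo_all; apply: fo_iff; first exact: fo_mem.
  by apply: fo_or; exact: fo_eq.
apply: fo_equiv foU _ => e eM; split=> [H|-> w _]; last exact: V_pairing.
apply: V_extensionality => w; rewrite V_pairing; split=> [wk|wij].
  by apply/H => //; exact: Mtrans wk.
by apply/H => //; case: wij => ->; exact: eM.
Qed.

Lemma upair_in x y : x ∈ M -> y ∈ M -> upair x y ∈ M.
Proof.
move=> xM yM; have [z [zM zP]] := GBm_pairing MC xM yM.
suff -> : upair x y = z by [].
apply: V_extensionality => w; rewrite V_pairing; split=> [wxy|wz].
  by apply/zP => //; case: wxy => ->.
by apply/zP => //; exact: Mtrans wz.
Qed.

Lemma opair_in x y : x ∈ M -> y ∈ M -> ⟨x, y⟩ ∈ M.
Proof. by move=> xM yM; apply: upair_in; exact: upair_in. Qed.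

Lemma opair_in_inv x y : ⟨x, y⟩ ∈ M -> x ∈ M /\ y ∈ M.
Proof.
move=> xyM; have uM : upair x y ∈ M.
  by apply: Mtrans xyM _; apply/V_pairing; right.
by split; apply: Mtrans uM _; apply/V_pairing; [left|right].
Qed.

Lemma fo_eq_opair i j k : fo (fun e => e k = ⟨e i, e j⟩).
Proof.
have foO : fo (fun e => exists a, a ∈ M /\ exists b, b ∈ M /\
    (a = upair (e i) (e i) /\ (b = upair (e i) (e j) /\ e k = upair a b))).
  apply: fo_ex; apply: fo_ex.
  by apply: fo_and; [|apply: fo_and]; exact: fo_eq_upair.
apply: fo_equiv foO _ => e eM; split; first by move=> [a [_ [b [_ [-> [->]]]]]].
move=> ->; exists (upair (e i) (e i)); split; first exact: upair_in.
by exists (upair (e i) (e j)); split; first exact: upair_in.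
Qed.

Lemma fo_opair_mem i j k : fo (fun e => ⟨e i, e j⟩ ∈ e k).
Proof.
have foO : fo (fun e => exists z, z ∈ M /\ (z = ⟨e i, e j⟩ /\ z ∈ e k)).
  by apply: fo_ex; apply: fo_and; [exact: fo_eq_opair|exact: fo_mem].
apply: fo_equiv foO _ => e eM; split; first by move=> [z [_ [->]]].
by move=> h; exists ⟨e i, e j⟩; split=> //; exact: opair_in.
Qed.

Lemma fo_opair_class X i j : X ∈ C -> fo (fun e => ⟨e i, e j⟩ ∈ X).
Proof.
move=> XC; have foO : fo (fun e => exists z, z ∈ M /\ (z = ⟨e i, e j⟩ /\ z ∈ X)).
  by apply: fo_ex; apply: fo_and; [exact: fo_eq_opair|exact: fo_class].
apply: fo_equiv foO _ => e eM; split; first by move=> [z [_ [->]]].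
by move=> h; exists ⟨e i, e j⟩; split=> //; exact: opair_in.
Qed.

(** Comprehension for [v0 ∈ v1] with parameter [x] returns [x] itself, since transitivity puts its
    elements into [M]. *)
Lemma set_is_class x : x ∈ M -> x ∈ C.
Proof.
move=> xM; have [X [XC XP]] := fo_comprehension MC (fo_mem M C 0 1) (e := fun=> x) (fun=> xM).
suff -> : x = X by [].
apply: V_extensionality => z; rewrite XP /=; split=> [zx|[]//].
by split=> //; exact: Mtrans zx.
Qed.

Lemma empty_set_in : exists2 x, x ∈ M & forall z, ~ z ∈ x.
Proof.
have [_ [_ [[x [xM [_ x0]]] _]]] := GBm_infinity MC.
exists x => // z zx; exact: x0 (Mtrans xM zx) zx.
Qed.

End FirstOrder.

Ltac solve_renaming :=
  solve [repeat apply: renaming_scons; first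
    [ exact: (renaming_shift 0) | exact: (renaming_shift 1)
    | exact: (renaming_shift 2) | exact: (renaming_shift 3)
    | exact: (renaming_shift 4) ]].

(** Relations given by a hypothesis are recognised first, up to renaming of variables; the others
    are decomposed along their logical structure down to atomic ones. *)
Ltac solve_fo :=
  cbv beta;
  first
  [ assumption
  | apply: fo_subst; [eassumption | solve_renaming]
  | apply: fo_all; solve_fo
  | apply: fo_ex; solve_fo
  | apply: fo_not; solve_fo
  | apply: fo_and; solve_fo
  | apply: fo_or; solve_fo
  | apply: fo_iff; solve_fo
  | apply: fo_eq_upair; assumption
  | apply: fo_eq_opair; assumption
  | apply: fo_opair_class; assumption
  | apply: fo_opair_mem; assumption
  | apply: fo_class; assumption
  | apply: fo_mem
  | apply: fo_eq
  | apply: fo_imply; solve_fo ].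

(** * Generic filters and captured properties *)

Section Forcing.
Variables M C P le : V.
Hypotheses (MC : GBm_model M C) (Mtrans : transitive_set M).
Hypotheses (PC : P ∈ C) (leC : le ∈ C) (Ple : preorder_on P le).
Notation fo := (first_order M C).
Notation N := (names M P).

(** The Rasiowa-Sikorski construction: a descending sequence starting at [p] enters the dense
    classes one by one, and its upward closure is generic. *)
Lemma generic_exists p : countable_set C -> p ∈ P ->
  exists G, generic C P le G /\ p ∈ G.
Proof.
have [le_P le_refl le_trans] := Ple.
move=> /countable_injP[f f_inj] pP.
(* [g (n, q)] extends [q] into the dense class with index [n], which is unique by injectivity of
   [f]; if there is none, it can be [q] itself. *)
have /choice[g gP] : forall nq : nat * V, exists q, nq.2 ∈ P ->
    ⟨q, nq.2⟩ ∈ le /\ forall D, D ∈ C -> f D = nq.1 -> dense_in P le D -> q ∈ D.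
  move=> [n q] /=.
  have [[D [DC Dn Dd]]|noD] := pselect (exists D, [/\ D ∈ C, f D = n & dense_in P le D]).
    have [qP|nqP] := pselect (q ∈ P); last by exists q.
    have [d [dD dq]] := Dd.2 q qP; exists d => _; split=> // D' D'C D'n _.
    by rewrite (f_inj D' D)// ?inE// D'n.
  exists q => qP; split; first exact: le_refl.
  by move=> D DC Dn Dd; case: noD; exists D.
(* The dense class with index [n] is met at stage [n + 1]. *)
pose s := fix s n := if n is k.+1 then g (k, s k) else p.
have sP n : s n ∈ P.
  elim: n => //= n IH; have [/le_P[x [y [/opair_inj[-> _] []]]]//] := gP (n, s n) IH.
have s_step n : ⟨s n.+1, s n⟩ ∈ le by have [] := gP (n, s n) (sP n).
have s_le m n : ⟨s (m + n), s n⟩ ∈ le.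
  elim: m => [|m IH]; first exact: le_refl.
  exact: le_trans (s_step _) IH.
exists (sep P (fun q => exists n, ⟨s n, q⟩ ∈ le)).
split; last by apply/V_separation; split=> //; exists 0; exact: le_refl.
split; last first.
  move=> D DC Dd; exists (s (f D).+1); have [_ sD] := gP (f D, s (f D)) (sP _).
  split; last exact: sD.
  by apply/V_separation; split=> //; exists (f D).+1; exact: le_refl.
split.
- by move=> q /V_separation[].
- by exists p; apply/V_separation; split=> //; exists 0; exact: le_refl.
- move=> q r /V_separation[_ [n nq]] qr; apply/V_separation; split.
    by have [x [y [/opair_inj[_ ->] []]]] := le_P _ qr.
  by exists n; exact: le_trans nq qr.
- move=> q r /V_separation[_ [m mq]] /V_separation[_ [n nr]].
  exists (s (m + n)); split.
  + by apply/V_separation; split=> //; exists (m + n); exact: le_refl.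
  + by apply: le_trans mq; rewrite addnC.
  + exact: le_trans (s_le _ _) nr.
Qed.

Lemma condition_in p : p ∈ P -> p ∈ M.
Proof. exact: (GBm_classes MC PC). Qed.

Lemma le_conditions p q : ⟨p, q⟩ ∈ le -> p ∈ P /\ q ∈ P.
Proof. by have [le_P _ _] := Ple; move=> /le_P[x [y [/opair_inj[-> ->]]]]. Qed.

(** Comprehension collects the conditions satisfying [R] into a dense class that belongs to [C]. *)
Lemma generic_meets G R e : generic C P le G -> fo R -> env_in M e ->
  (forall p, p ∈ P -> exists q, ⟨q, p⟩ ∈ le /\ R (q .: e)) ->
  exists q, q ∈ G /\ R (q .: e).
Proof.
move=> [_ Gd] foR eM Rd; have foR' : fo (fun e => e 0 ∈ P /\ R e) by solve_fo.
have [D [DC DP]] := fo_comprehension MC foR' eM.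
have [|q [qG /DP[_ [_ Rq]]]] := Gd D DC; last by exists q.
split=> [d /DP[_ []]//|p pP]; have [q [qp Rq]] := Rd p pP.
have [qP _] := le_conditions qp.
by exists q; split=> //; apply/DP; split; [exact: condition_in|].
Qed.

Lemma names_in s : s ∈ N -> s ∈ M.
Proof. by case/V_separation. Qed.

Lemma env_in_names e : env_in N e -> env_in M e.
Proof. by move=> eN i; exact: names_in. Qed.

Definition forced (Phi : V -> (nat -> V) -> Prop) (p : V) (e : nat -> V) : Prop :=
  forall G, generic C P le G -> p ∈ G -> Phi G e.

(** For names, [O] holds only at conditions forcing [Phi], but it may miss some of them and may fail
    to pass to stronger conditions. *)
Definition captured (Phi : V -> (nat -> V) -> Prop) : Prop :=
  exists O, fo O /\ forall G e, generic C P le G -> env_in N e ->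
    (Phi G e <-> exists p, p ∈ G /\ O (p .: e)).

Lemma captured_equiv Phi Psi : captured Phi ->
  (forall G e, generic C P le G -> env_in N e -> (Phi G e <-> Psi G e)) ->
  captured Psi.
Proof. by move=> [O [foO OP]] E; exists O; split=> // G e gG eN; rewrite -E// OP. Qed.

Lemma captured_truth Phi G e : captured Phi -> generic C P le G -> env_in N e ->
  Phi G e -> exists p, p ∈ G /\ forced Phi p e.
Proof.
move=> [O [_ OP]] gG eN /(OP G e gG eN)[p [pG Op]]; exists p; split=> // H gH pH.
by apply/(OP H e gH eN); exists p.
Qed.

Lemma captured_not Phi : captured Phi -> captured (fun G e => ~ Phi G e).
Proof.
move=> [O [foO OP]].
(* [O1] describes the conditions below a witness of [Phi], and [O2] those without an extension
   satisfying [O1]. The negation is captured by [O2]. *)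
pose O1 e := exists s, s ∈ M /\ (⟨e 0, s⟩ ∈ le /\ O (s .: (fun i => e i.+1))).
pose O2 e := ~ exists q, q ∈ M /\ (⟨q, e 0⟩ ∈ le /\ O1 (q .: (fun i => e i.+1))).
have foO1 : fo O1 by rewrite /O1; solve_fo.
have foO2 : fo O2 by rewrite /O2; solve_fo.
exists O2; split=> // G e gG eN; have [[GP _ Gup Gdir] _] := gG; split.
  move=> nPhi; have [|p pP|p [pG [O1p|O2p]]] :=
      @generic_meets G (fun e => O1 e \/ O2 e) e gG _ (env_in_names eN).
  - by solve_fo.
  - have [[q [_ [qp O1q]]]|nq] := pselect
        (exists q, q ∈ M /\ (⟨q, p⟩ ∈ le /\ O1 (q .: e))).
      by exists q; split=> //; left.
    by exists p; split; [have [] := Ple; auto|right].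
  - case: nPhi; apply/OP => //; have [s [_ [ps Os]]] := O1p.
    by exists s; split=> //; exact: Gup ps.
  - by exists p.
(* A common extension in [G] of [p] and a witness [s] of [Phi] would satisfy [O1], against [O2] at
   [p]. *)
move=> [p [pG O2p]] /(OP G e gG eN)[s [sG Os]]; apply: O2p.
have [r [rG rp rs]] := Gdir _ _ pG sG.
exists r; split; first exact/condition_in/GP.
by split=> //; exists s; split=> //; exact/condition_in/GP.
Qed.

(** The quantification over generic filters in forcing is replaced by one over conditions, using
    witnesses of the negation. *)
Lemma captured_definable Phi : countable_set C -> captured Phi ->
  exists R, fo R /\ forall p e, p ∈ P -> env_in N e ->
    (R (p .: e) <-> forced Phi p e).
Proof.
move=> Cct /captured_not[O [foO OP]].
exists (fun e => ~ exists r, r ∈ M /\ (⟨r, e 0⟩ ∈ le /\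
  exists s, s ∈ M /\ (⟨r, s⟩ ∈ le /\ O (s .: (fun i => e i.+1))))).
split=> [|p e pP eN /=]; first by solve_fo.
split=> [H G gG pG|pf [r [_ [rp [s [_ [rs Os]]]]]]].
  apply: contrapT => /(OP G e gG eN)[s [sG Os]]; apply: H.
  have [[GP _ Gup Gdir] _] := gG; have [r [rG rp rs]] := Gdir _ _ pG sG.
  exists r; split; first exact/condition_in/GP.
  by split=> //; exists s; split=> //; exact/condition_in/GP.
(* A generic filter through [r] contains both [p] and the witness [s], so [Phi] would hold and fail
   in it. *)
have [rP _] := le_conditions rp; have [G [gG rG]] := generic_exists Cct rP.
have [[GP _ Gup Gdir] _] := gG.
have : ~ Phi G e by apply/OP => //; exists s; split=> //; exact: Gup rs.
by apply; apply: pf => //; exact: Gup rp.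
Qed.

Lemma captured_and Phi Psi : captured Phi -> captured Psi ->
  captured (fun G e => Phi G e /\ Psi G e).
Proof.
move=> [O [foO OP]] [O' [foO' OP']].
(* Since the two relations need not pass to stronger conditions, the new one asks for a condition
   below a witness of each. *)
exists (fun e => exists p, p ∈ M /\ exists q, q ∈ M /\
  (⟨e 0, p⟩ ∈ le /\ (⟨e 0, q⟩ ∈ le /\
  (O (p .: (fun i => e i.+1)) /\ O' (q .: (fun i => e i.+1)))))).
split=> [|G e gG eN]; first by solve_fo.
have [[GP _ Gup Gdir] _] := gG; rewrite OP// OP'//; split.
  move=> [[p [pG Op]] [q [qG O'q]]]; have [r [rG rp rq]] := Gdir _ _ pG qG.
  exists r; split=> //; exists p; split; first exact/condition_in/GP.
  by exists q; split; first exact/condition_in/GP.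
move=> [r [rG [p [_ [q [_ [rp [rq [Op O'q]]]]]]]]].
by split; [exists p|exists q]; split=> //; [exact: Gup rp|exact: Gup rq].
Qed.

Lemma captured_rename Phi f : captured Phi ->
  captured (fun G e => Phi G (e \o f)).
Proof.
move=> [O [foO OP]]; exists (fun e => O (e 0 .: (fun i => e (f i).+1))); split.
  apply: fo_subst => //; apply: renaming_scons.
  by exists (fun i => (f i).+1).
by move=> G e gG eN; rewrite OP // => i; exact: eN.
Qed.

Hypothesis NC : N ∈ C.

Lemma captured_ex (Phi : V -> V -> (nat -> V) -> Prop) :
  captured (fun G e => Phi (e 0) G (fun i => e i.+1)) ->
  captured (fun G e => exists s, s ∈ N /\ Phi s G e).
Proof.
move=> [O [foO OP]].
(* The condition stays variable 0 of [O]; the quantified name is inserted as variable 1. *)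
exists (fun e => exists s, s ∈ M /\ (s ∈ N /\ O (e 0 .: (s .: (fun i => e i.+1))))).
split=> [|G e gG eN]; first by solve_fo.
have OPs s : s ∈ N -> (Phi s G e <-> exists p, p ∈ G /\ O (p .: (s .: e))).
  by move=> sN; rewrite -OP//; exact: env_in_scons.
split.
  move=> [s [sN /OPs[//|p [pG Op]]]]; exists p; split=> //.
  by exists s; split=> //; exact: names_in.
by move=> [p [pG [s [_ [sN Op]]]]]; exists s; split=> //; apply/OPs => //; exists p.
Qed.

(** The condition attached to the name in [B] is itself the witness in [G]; putting it in front
    shifts [i] by one. *)
Lemma captured_in_dom B i : B ∈ C ->
  captured (fun G e => exists p, p ∈ G /\ ⟨e i, p⟩ ∈ B).
Proof. by move=> BC; exists (fun e => ⟨e i.+1, e 0⟩ ∈ B); split; first by solve_fo. Qed.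

Lemma captured_in_dom_name i j :
  captured (fun G e => exists p, p ∈ G /\ ⟨e i, p⟩ ∈ e j).
Proof. by exists (fun e => ⟨e i.+1, e 0⟩ ∈ e j.+1); split; first by solve_fo. Qed.

Lemma names_are_class_names s : s ∈ N -> s ∈ names C P.
Proof.
move=> /V_separation[sM sP]; apply/V_separation; split=> //.
exact: set_is_class MC Mtrans _ sM.
Qed.

Lemma name_elements B t p : B ∈ names C P -> ⟨t, p⟩ ∈ B -> t ∈ N /\ p ∈ P.
Proof.
move=> /V_separation[BC BP] tpB.
have [tM _] := opair_in_inv Mtrans (GBm_classes MC BC tpB).
case: BP tpB => {BC} B BP /BP[t' [p' [/opair_inj[<- <-] [tP pP]]]].
by split=> //; apply/V_separation.
Qed.

(** [Phi] has to agree with equality of values only on the domains of [B] and [B'], which is what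
    the induction in [captured_eq] can supply. *)
Lemma captured_subset (B B' : V) (Phi : V -> V -> V -> Prop) :
  B ∈ names C P -> B' ∈ names C P ->
  captured (fun G e => Phi (e 0) (e 1) G) ->
  (forall s t G, in_dom s B -> in_dom t B' -> (Phi s t G <-> eval G s = eval G t)) ->
  captured (fun G _ => forall x, x ∈ eval G B -> x ∈ eval G B').
Proof.
move=> BN B'N cPhi PhiP.
have /V_separation[BC _] := BN; have /V_separation[B'C _] := B'N.
have c : captured (fun G e => ~ exists s, s ∈ N /\
    ((exists p, p ∈ G /\ ⟨s, p⟩ ∈ B) /\ ~ exists t, t ∈ N /\
    ((exists p, p ∈ G /\ ⟨t, p⟩ ∈ B') /\ Phi s t G))).
  apply: captured_not; apply: captured_ex; apply: captured_and.
    exact: captured_in_dom.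
  apply: captured_not; apply: captured_ex; apply: captured_and.
    exact: captured_in_dom.
  (* The inner quantifier makes [t] variable 0 and [s] variable 1, whereas [cPhi] expects them in
     the other order. *)
  exact: (captured_rename (fun i => if i is 0 then 1 else 0) cPhi).
apply: captured_equiv c _ => G e _ _; split=> [H x|H [s [_ [[p [pG sB]] nt]]]].
  move=> /evalP[s [[p [pG sB]] ->]]; apply: contrapT => nB'; apply: H.
  exists s; split; first by have [] := name_elements BN sB.
  split; first by exists p.
  move=> [t [tN [[q [qG tB']] st]]]; apply: nB'; apply/evalP; exists t.
  by split; [exists q|apply/PhiP => //; [exists p|exists q]].
have /H/evalP[t [[q [qG tB']] st]] : eval G s ∈ eval G B.
  by apply/evalP; exists s; split=> //; exists p.
apply: nt; exists t; split; first by have [] := name_elements B'N tB'.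
by split; [exists q|apply/PhiP => //; [exists p|exists q]].
Qed.

(** * Capturing equality, membership and all formulas *)

Hypothesis Cct : countable_set C.
Hypothesis eq_definable : exists E, fo E /\ forall p e, p ∈ P -> env_in N e ->
  (E (p .: e) <-> forced (fun G e => eval G (e 0) = eval G (e 1)) p e).

Lemma captured_eq i j : captured (fun G e => eval G (e i) = eval G (e j)).
Proof.
suff c01 : captured (fun G e => eval G (e 0) = eval G (e 1)).
  exact: (captured_rename (fun k => if k is 0 then i else j) c01).
have [E [foE EP]] := eq_definable.
suff truth s : forall e G, e 0 = s -> env_in N e -> generic C P le G ->
    eval G (e 0) = eval G (e 1) ->
    exists p, p ∈ G /\ forced (fun G e => eval G (e 0) = eval G (e 1)) p e.
  (* Given the truth lemma, the definable forcing relation itself captures equality; [E] is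
     controlled only at conditions, hence the first conjunct. *)
  exists (fun e => e 0 ∈ P /\ E e); split=> [|G e gG eN]; first by solve_fo.
  have [[GP _ _ _] _] := gG; split.
    move=> /(truth _ e G erefl eN gG)[p [pG pE]]; exists p; split=> //.
    by split; [exact: GP|apply/EP => //; exact: GP].
  by move=> [p [pG [pP /(EP _ _ pP eN) pE]]]; exact: pE.
elim/(well_founded_ind in_dom_wf): s => s IH e G es eN gG st.
(* By the induction hypothesis, [E] captures equality once the left name is restricted to the domain
   of [s]; the right name remains arbitrary. *)
have c : captured (fun G e => in_dom (e 0) s /\ eval G (e 0) = eval G (e 1)).
  have sC : s ∈ C by apply: set_is_class MC Mtrans _ _; rewrite -es; exact: names_in.
  exists (fun e => (exists p, p ∈ M /\ ⟨e 1, p⟩ ∈ s) /\ (e 0 ∈ P /\ E e)).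
  split=> [|H e' gH e'N]; first by solve_fo.
  have [[HP _ _ _] _] := gH; split.
    move=> [e's /(IH _ e's _ _ erefl e'N gH)[p [pH pE]]]; exists p; split=> //.
    split; last by split; [exact: HP|apply/EP => //; exact: HP].
    have [q qs] := e's; exists q; split=> //; apply: condition_in.
    suff /name_elements/(_ qs)[] : s ∈ names C P by [].
    by apply: names_are_class_names; rewrite -es.
  move=> [p [pH [[q [_ qs]] [pP /(EP _ _ pP e'N) pE]]]].
  by split; [exists q|exact: pE].
have eC k : e k ∈ names C P by exact: names_are_class_names.
have c1 : captured (fun G _ => forall x, x ∈ eval G (e 0) -> x ∈ eval G (e 1)).
  apply: (captured_subset (Phi := fun x y G => in_dom x s /\ eval G x = eval G y)
    (eC _) (eC _) c) => x y H xs _; rewrite es in xs.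
  by split=> [[]|].
have c2 : captured (fun G _ => forall x, x ∈ eval G (e 1) -> x ∈ eval G (e 0)).
  (* For the reverse inclusion the name from the domain of [s] is the second one, so the variables
     are swapped. *)
  have c' := captured_rename (fun k => if k is 0 then 1 else 0) c.
  apply: (captured_subset (Phi := fun y x G => in_dom x s /\ eval G x = eval G y)
    (eC _) (eC _) c') => y x H _ xs; rewrite es in xs.
  by split=> [[_ ->]|->].
(* The two inclusions are captured together, so a single condition in [G] forces both. *)
have [|p [pG pst]] := captured_truth (captured_and c1 c2) gG eN.
  by rewrite st.
exists p; split=> // H gH pH; have [st1 st2] := pst H gH pH.
by apply: V_extensionality => x; split; [exact: st1|exact: st2].
Qed.

(** This handles the predicates: assignments take values among the names in [M], so a class name
    enters as a fixed parameter. *)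
Lemma captured_mem_class_name B i : B ∈ names C P ->
  captured (fun G e => eval G (e i) ∈ eval G B).
Proof.
move=> BN; have /V_separation[BC _] := BN.
have c : captured (fun G e => exists t, t ∈ N /\
    ((exists p, p ∈ G /\ ⟨t, p⟩ ∈ B) /\ eval G (e i) = eval G t)).
  apply: captured_ex; apply: captured_and; first exact: captured_in_dom.
  exact: (captured_eq i.+1 0).
apply: captured_equiv c _ => G e _ _; rewrite evalP; split.
  by move=> [t [_ tP]]; exists t.
move=> [t [[p [pG tB]] ti]]; exists t; split; first by have [] := name_elements BN tB.
by split=> //; exists p.
Qed.

Lemma captured_mem i j : captured (fun G e => eval G (e i) ∈ eval G (e j)).
Proof.
have c : captured (fun G e => exists t, t ∈ N /\
    ((exists p, p ∈ G /\ ⟨t, p⟩ ∈ e j) /\ eval G (e i) = eval G t)).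
  apply: captured_ex; apply: captured_and; first exact: (captured_in_dom_name 0 j.+1).
  exact: (captured_eq i.+1 0).
apply: captured_equiv c _ => G e _ eN; rewrite evalP; split.
  by move=> [t [_ tP]]; exists t.
move=> [t [[p [pG tj]] ti]]; exists t; split.
  by have [] := name_elements (names_are_class_names (eN j)) tj.
by split=> //; exists p.
Qed.

(** Each element of the extension is the value of a name in [M], so its quantifiers become
    quantifiers over names. *)
Lemma captured_sat n m (phi : formula n m) (Gamma : n.-tuple V) :
  tuple_in (mem^~ (names C P)) Gamma ->
  captured (fun G e => sat (extension M P G) (eval_tuple G Gamma) phi
    [tuple eval G (e i) | i < m]).
Proof.
move=> GammaN; elim: phi => {m} /=.
- move=> m i j; apply: captured_equiv (captured_mem i j) _ => G e _ _.
  by rewrite !tnth_mktuple.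
- move=> m i j; apply: captured_equiv (captured_eq i j) _ => G e _ _.
  by rewrite !tnth_mktuple.
- move=> m k i.
  apply: captured_equiv (captured_mem_class_name i (GammaN k)) _ => G e _ _.
  by rewrite tnth_mktuple tnth_map.
- by move=> m phi; exact: captured_not.
- by move=> m phi IHphi psi IHpsi; exact: captured_and.
- move=> m phi IH.
  have c : captured (fun G e => exists s, s ∈ N /\
      sat (extension M P G) (eval_tuple G Gamma) phi
        [tuple eval G ((s .: e) i) | i < m.+1]).
    apply: captured_ex; apply: captured_equiv IH _ => G e _ _.
    by rewrite -scons_eta.
  apply: captured_equiv c _ => G e _ _.
  have E s : [tuple eval G ((s .: e) i) | i < m.+1] =
      [tuple of eval G s :: [tuple eval G (e i) | i < m]].
    by rewrite (mktuple_cons (fun i => eval G ((s .: e) i))).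
  split; first by move=> [s [sN]]; rewrite E => ?; exists (eval G s); split=> //;
    apply/V_replacement; exists s.
  by move=> [_ [/V_replacement[s [sN ->]]]]; rewrite -E => ?; exists s.
Qed.

End Forcing.

(** * Classes of coded tuples *)

Lemma foldr_scons_nth (s : seq V) e x i :
  foldr scons e s i = if i < size s then nth x s i else e (i - size s).
Proof. by elim: s i => [|y s IH] [|i] //=; rewrite ?subn0 // IH. Qed.

Lemma fo_ex_seq M C N Q m x : N ∈ C -> (forall s, s ∈ N -> s ∈ M) ->
  first_order M C Q ->
  first_order M C (fun e => exists s : seq V,
    [/\ size s = m, forall i, i < m -> nth x s i ∈ N & Q (foldr scons e s)]).
Proof.
move=> NC NM foQ; elim: m => [|m IH].
  apply: fo_equiv foQ _ => e _; split=> [Qe|[s [/size0nil-> _]]//].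
  by exists [::].
apply: fo_equiv (fo_ex_scons (fo_and (fo_class M 0 NC) IH)) _ => e _; split.
  (* The outermost quantifier supplies the last entry, because [foldr scons] puts that entry
     deepest, directly before [e]. *)
  move=> [y [_ [yN [s [sm sN Qs]]]]]; exists (rcons s y).
  rewrite size_rcons sm foldr_rcons; split=> // i im; rewrite nth_rcons sm.
  rewrite ltnS leq_eqVlt in im.
  by case/predU1P: im => [->|im]; rewrite ?ltnn ?eqxx ?im //; exact: sN.
move=> [s]; case: (lastP s) => [[]//|{}s y]; rewrite size_rcons => -[[sm] sN Qs].
have yN : y ∈ N by have := sN m (leqnn _); rewrite nth_rcons sm ltnn eqxx.
exists y; split; first exact: NM.
split=> //; exists s; split=> //; last by rewrite -foldr_rcons.
by move=> i im; have := sN i (leqW im); rewrite nth_rcons sm im.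
Qed.

(** Each step names the intermediate pair by a quantifier; the map [f] absorbs the resulting shift
    of the variables in [l]. *)
Lemma fo_eq_foldl_opair M C j k (f : nat -> nat) l :
  GBm_model M C -> transitive_set M ->
  first_order M C (fun e => e k = foldl opair (e j) [seq e (f i) | i <- l]).
Proof.
move=> MC Mtrans; elim: l f j k => [|a l IH] f j k; first exact: fo_eq.
have foE : first_order M C (fun e => exists w, w ∈ M /\ (w = ⟨e j, e (f a)⟩ /\
    e k = foldl opair w [seq e (f i) | i <- l])).
  apply: fo_ex; apply: fo_and; first exact: (fo_eq_opair MC Mtrans).
  exact: (IH (fun i => (f i).+1) 0 k.+1).
apply: fo_equiv foE _ => e eM; split=> [[w [_ [->]]]//|ek].
by exists ⟨e j, e (f a)⟩; split; first exact: (opair_in MC Mtrans).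
Qed.

Lemma fo_tuple_class M C P N R m e0 : GBm_model M C -> transitive_set M ->
  P ∈ C -> N ∈ C -> env_in N e0 -> first_order M C R ->
  exists X, X ∈ C /\ forall z, z ∈ X <-> exists p (s : m.-tuple V),
    [/\ z = tuple_code p s, p ∈ P, tuple_in (mem^~ N) s
      & R (p .: foldr scons e0 s)].
Proof.
move=> MC Mtrans PC NC e0N foR.
have NM s : s ∈ N -> s ∈ M by exact: (GBm_classes MC NC).
have PM p : p ∈ P -> p ∈ M by exact: (GBm_classes MC PC).
(* Once the tuple is bound, variables below [m] are its entries, variable [m] is the candidate code
   [z], and [e0] follows. [skip] leaves out [z]. *)
pose skip i := if i < m then i else i.+1.
have foQ : first_order M C (fun e => exists p, p ∈ M /\ (p ∈ P /\
    (e m = foldl opair p [seq e i | i <- iota 0 m] /\ R (p .: (e \o skip))))).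
  apply: fo_ex; apply: fo_and; first exact: fo_class.
  apply: fo_and; first exact: (fo_eq_foldl_opair 0 m.+1 succn).
  apply: fo_subst foR _; apply: renaming_scons.
  by exists (fun i => (skip i).+1).
have [X [XC XP]] := fo_comprehension MC (fo_ex_seq m (e0 0) NC NM foQ)
  (fun i => NM _ (e0N i)).
have sE z (s : seq V) : size s = m -> foldr scons (z .: e0) s \o skip = foldr scons e0 s.
  move=> sm; apply: funext => i; rewrite /skip /= !(foldr_scons_nth _ _ z) sm.
  by case: (ltnP i m) => [->//|mi]; rewrite ltnNge leqW//= subSn.
have cE z (s : seq V) : size s = m ->
    [seq foldr scons (z .: e0) s i | i <- iota 0 m] = s.
  move=> sm; apply: (@eq_from_nth _ z); first by rewrite size_map size_iota.
  move=> i; rewrite size_map size_iota => im.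
  by rewrite (nth_map 0) ?size_iota// nth_iota// add0n (foldr_scons_nth _ _ z) sm im.
exists X; split=> // z; rewrite XP; split.
  move=> [_ [s [sm sN [p [_ [pP [zE Rp]]]]]]].
  have sm' : size s == m by apply/eqP.
  exists p, (Tuple sm'); split=> //=.
  - by move: zE; rewrite cE// (foldr_scons_nth _ _ z) sm ltnn subnn.
  - by move=> i; rewrite (tnth_nth (e0 0)); exact: sN.
  - by rewrite -(sE z).
move=> [p [s [zE pP sN Rp]]]; split.
  (* Comprehension collects only elements of [M], so the code must be shown to lie there. *)
  suff codeM (t : seq V) : forall q, q ∈ M ->
      (forall i, i < size t -> nth (e0 0) t i ∈ M) -> foldl opair q t ∈ M.
    rewrite zE; apply: codeM; first exact: PM.
    move=> i; rewrite size_tuple => im; apply: NM.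
    by have := sN (Ordinal im); rewrite (tnth_nth (e0 0)).
  elim: t => //= y t IH q qM tM; apply: IH; last by move=> i; exact: (tM i.+1).
  by apply: (opair_in MC Mtrans) qM _; exact: (tM 0).
exists s; rewrite size_tuple; split=> //.
  by move=> i im; have := sN (Ordinal im); rewrite (tnth_nth (e0 0)).
exists p; split; first exact: PM.
split=> //; split; last by rewrite sE ?size_tuple.
by rewrite cE ?size_tuple// (foldr_scons_nth _ _ z) size_tuple ltnn subnn.
Qed.

(** * Derivation of the forcing theorem from definability *)

Section ForcingTheorem.
Variables M C P le : V.
Hypotheses (hM : countable_transitive_model_GBm M C) (hP : class_forcing C P le).

Lemma forcing_theorem_of_eq n m (phi : formula n m) :
  names M P ∈ C ->
  (exists E, first_order M C E /\ forall p e, p ∈ P -> env_in (names M P) e ->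
    (E (p .: e) <-> forced C P le (fun G e => eval G (e 0) = eval G (e 1)) p e)) ->
  forcing_theorem M C P le phi.
Proof.
move=> NC eq_def; have [MC Mtrans _ Cct] := hM; have [Ple PC leC] := hP.
have [x0 x0M x0_empty] := empty_set_in MC Mtrans.
have x0N : x0 ∈ names M P.
  by apply/V_separation; split=> //; constructor=> x /x0_empty.
(* Tuples are extended to infinite assignments by the empty name. *)
pose e0 : nat -> V := fun=> x0; have e0N : env_in (names M P) e0 by [].
pose Phi Gamma G (e : nat -> V) :=
  sat (extension M P G) (eval_tuple G Gamma) phi [tuple eval G (e i) | i < m].
have cPhi Gamma : tuple_in (mem^~ (names C P)) Gamma ->
    captured M C P le (Phi Gamma).
  by move=> GammaN; exact: captured_sat.
have sN (s : m.-tuple V) : tuple_in (mem^~ (names M P)) s ->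
    env_in (names M P) (foldr scons e0 s).
  move=> sN i; rewrite (foldr_scons_nth _ _ x0) size_tuple.
  by case: ltnP => // im; have := sN (Ordinal im); rewrite (tnth_nth x0).
have PhiE Gamma G (s : m.-tuple V) :
    Phi Gamma G (foldr scons e0 s) = ext_sat M P G Gamma phi s.
  congr (sat _ _ _ _); apply: eq_from_tnth => i.
  by rewrite tnth_mktuple tnth_map (foldr_scons_nth _ _ x0) size_tuple ltn_ord -tnth_nth.
have forcesE Gamma p (s : m.-tuple V) :
    forced C P le (Phi Gamma) p (foldr scons e0 s) <-> forces M C P le Gamma p phi s.
  by split=> H G gG pG; have := H G gG pG; rewrite PhiE.
split.
  move=> Gamma GammaN.
  have [R [foR RP]] := captured_definable MC Mtrans PC leC Ple Cct (cPhi _ GammaN).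
  have [X [XC XP]] := fo_tuple_class m MC Mtrans PC NC e0N foR.
  exists X; split=> // z; rewrite XP.
  by split=> -[p [s [zE pP sN' Rp]]]; exists p, s; split=> //;
    [apply/forcesE/RP => //|apply/RP => //; last exact/forcesE]; exact: sN.
move=> s Gamma sN' GammaN G gG; rewrite -PhiE => PhiG.
have [p [pG pPhi]] := captured_truth (cPhi _ GammaN) gG (sN _ sN') PhiG.
by exists p; split=> //; exact/forcesE.
Qed.

(** Without conditions there are no filters and the forcing relation is empty. This case is separate
    because [names_class_of_eq] needs a condition. *)
Lemma forcing_theorem_of_empty n m (phi : formula n m) :
  (forall p, ~ p ∈ P) -> forcing_theorem M C P le phi.
Proof.
move=> P0; have [MC Mtrans _ _] := hM.
have [x0 x0M x0_empty] := empty_set_in MC Mtrans.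
split; last by move=> s Gamma _ _ G [[GP [p pG] _ _] _]; case: (P0 p); exact: GP.
move=> Gamma _; exists x0; split; first exact: set_is_class MC Mtrans _ x0M.
by move=> z; split=> [/x0_empty//|[p [s [_ /P0]]]].
Qed.

Lemma definability_class2 (phi : formula 0 2) : definability_lemma M C P le phi ->
  exists X, X ∈ C /\ forall p s t, ⟨⟨p, s⟩, t⟩ ∈ X <->
    [/\ p ∈ P, s ∈ names M P, t ∈ names M P
      & forces M C P le [tuple] p phi [tuple s; t]].
Proof.
move=> phi_def; have [|X [XC XP]] := phi_def [tuple]; first by case.
exists X; split=> // p s t; rewrite XP; split.
  move=> [q [u [zE qP uN qphi]]].
  have uE : u = [tuple tnth u ord0; tnth u ord_max].
    by apply: eq_from_tnth => -[[|[|[]]]// i2]; rewrite !(tnth_nth s).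
  rewrite uE in zE qphi; have /opair_inj[/opair_inj[-> ->] ->] := zE.
  by split.
move=> [pP sN tN pphi]; exists p, [tuple s; t]; split=> // i.
by rewrite (tnth_nth s); case: i => -[|[|]].
Qed.

(* s is a name in M iff some condition forces s = s. *)
Lemma names_class_of_eq E :
  first_order M C E ->
  (forall e, env_in M e -> (E e <-> [/\ e 0 ∈ P, e 1 ∈ names M P, e 2 ∈ names M P &
    forall G, generic C P le G -> e 0 ∈ G -> eval G (e 1) = eval G (e 2)])) ->
  (exists p, p ∈ P) -> names M P ∈ C.
Proof.
move=> foE EP [p pP]; have [MC Mtrans _ _] := hM; have [_ PC _] := hP.
have pM : p ∈ M by exact: (GBm_classes MC PC).
(* Variable 0 is the candidate name [s] and variable 1 the fixed condition [p]; [E] is applied to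
   [p], [s], [s]. *)
have foN : first_order M C (fun e => E (e 1 .: (e 0 .: (e 0 .: e)))).
  by apply: fo_subst foE _; solve_renaming.
have [X [XC XP]] := fo_comprehension MC foN (e := fun=> p) (fun=> pM).
suff -> : names M P = X by [].
apply: V_extensionality => s; rewrite XP; split=> [sN|[sM]].
  have sM : s ∈ M by case/V_separation: sN.
  by split=> //; apply/EP => [[|[|[|[|]]]]|].
by move=> /EP[[|[|[|[|]]]]|].
Qed.

End ForcingTheorem.

Theorem theorem4p3 (M C P le : V)
    (hM : countable_transitive_model_GBm M C) (hP : class_forcing C P le)
    (hdef : definability_lemma M C P le v0_in_v1 \/
            definability_lemma M C P le v0_eq_v1)
    (n m : nat) (phi : formula n m) :
  forcing_theorem M C P le phi.
Proof.
have [MC Mtrans _ _] := hM; have [_ PC _] := hP.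
have [P_inh|P0] := pselect (exists p, p ∈ P); last first.
  by apply: forcing_theorem_of_empty => // p pP; apply: P0; exists p.
have NM s : s ∈ names M P -> s ∈ M by case/V_separation.
have PM p : p ∈ P -> p ∈ M by exact: (GBm_classes MC PC).
(* Being a name is part of what [E] expresses, because membership of [names M P] in [C] is itself
   derived from [E]. *)
suff [E [foE EP]] : exists E, first_order M C E /\ forall e, env_in M e ->
    (E e <-> [/\ e 0 ∈ P, e 1 ∈ names M P, e 2 ∈ names M P &
    forall G, generic C P le G -> e 0 ∈ G -> eval G (e 1) = eval G (e 2)]).
  have NC := names_class_of_eq hM hP foE EP P_inh.
  apply: forcing_theorem_of_eq => //; exists E; split=> // p e pP eN.
  rewrite EP; last by apply: env_in_scons => [|i]; [exact: PM|exact: NM].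
  by split=> [[]//|pE]; split=> //; exact: eN.
case: hdef => /definability_class2[X [XC XP]]; last first.
  exists (fun e => exists z, z ∈ M /\ (z = ⟨e 0, e 1⟩ /\ ⟨z, e 2⟩ ∈ X)).
  split; first by solve_fo.
  move=> e eM; transitivity (⟨⟨e 0, e 1⟩, e 2⟩ ∈ X).
    split; first by move=> [z [_ [->]]].
    by move=> h; exists ⟨e 0, e 1⟩; split=> //; exact: (opair_in MC Mtrans).
  by rewrite XP; split=> -[? ? ? H]; split=> // G gG pG; have := H G gG pG;
    rewrite /ext_sat /= !tnth_map.
(* Membership is applied to [e 1] and the singleton name of [⟨e 2, e 0⟩], whose value is the
   singleton of the value of [e 2] whenever [e 0] is in [G]. *)
exists (fun e => exists z, z ∈ M /\ (z = ⟨e 0, e 1⟩ /\ exists u, u ∈ M /\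
  (u = ⟨e 2, e 0⟩ /\ exists t, t ∈ M /\ (t = upair u u /\ ⟨z, t⟩ ∈ X)))).
split; first by solve_fo.
move=> e eM; transitivity (⟨⟨e 0, e 1⟩, upair ⟨e 2, e 0⟩ ⟨e 2, e 0⟩⟩ ∈ X).
  split; first by move=> [z [_ [-> [u [_ [-> [t [_ [-> ]]]]]]]]].
  move=> h; exists ⟨e 0, e 1⟩; split; first exact: (opair_in MC Mtrans).
  split=> //; exists ⟨e 2, e 0⟩; split; first exact: (opair_in MC Mtrans).
  split=> //; exists (upair ⟨e 2, e 0⟩ ⟨e 2, e 0⟩); split=> //.
  by apply: (upair_in MC Mtrans); exact: (opair_in MC Mtrans).
have evalE G x : e 0 ∈ G ->
    x ∈ eval G (upair ⟨e 2, e 0⟩ ⟨e 2, e 0⟩) <-> x = eval G (e 2).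
  move=> pG; rewrite evalP; split=> [|->].
    by move=> [t [[q [_ /V_pairing]]]] [] /opair_inj[-> _].
  by exists (e 2); split=> //; exists (e 0); split=> //; apply/V_pairing; left.
rewrite XP; split=> -[pP sN tN H]; split=> //.
(* That [e 2] is a name is recovered from the singleton being one. *)
- have eN := names_are_class_names MC Mtrans tN.
  have u_el : ⟨e 2, e 0⟩ ∈ upair ⟨e 2, e 0⟩ ⟨e 2, e 0⟩ by apply/V_pairing; left.
  by have [] := name_elements MC Mtrans eN u_el.
- move=> G gG pG; apply/evalE => //.
  by have := H G gG pG; rewrite /ext_sat /= !tnth_map.
- apply/V_separation; split.
    by apply: (upair_in MC Mtrans); exact: (opair_in MC Mtrans).
  constructor=> x xu; exists (e 2), (e 0); have /V_separation[_ e2P] := tN.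
  by case/V_pairing: xu.
- move=> G gG pG; rewrite /ext_sat /= !tnth_map.
  by apply/evalE => //; exact: H.
Qed.
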